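(* Dominance $\gg$ is a transitive, and therefore an order, relation on the set $\{T^{\mathbf{SW}}_{\lambda}\mid\lambda\in[0,\infty]\}$ of all Sugeno-Weber t-norms. That is, on this set $\gg$ is reflexive, antisymmetric and transitive; in particular, for all $a,b,c\in[0,\infty]$, if $T^{\mathbf{SW}}_{a}\gg T^{\mathbf{SW}}_{b}$ and $T^{\mathbf{SW}}_{b}\gg T^{\mathbf{SW}}_{c}$, then $T^{\mathbf{SW}}_{a}\gg T^{\mathbf{SW}}_{c}$.
   Context: A t-norm is a binary operation $T\colon[0,1]^2\to[0,1]$ that is commutative, associative, increasing (non-decreasing in each argument) and has neutral element $1$. Dominance: for t-norms $T_1,T_2$, $T_1$ dominates $T_2$, written $T_1\gg T_2$, if for all $x,y,u,v\in[0,1]$, $$T_1(T_2(x,y),T_2(u,v))\geq T_2(T_1(x,u),T_1(y,v)).$$ The Sugeno-Weber t-norms $(T^{\mathbf{SW}}_{\lambda})_{\lambda\in[0,\infty]}$ are given, for $u,v\in[0,1]$, by $T^{\mathbf{SW}}_{0}(u,v)=uv$ (the product); $T^{\mathbf{SW}}_{\infty}(u,v)=\min(u,v)$ if $\max(u,v)=1$ and $T^{\mathbf{SW}}_{\infty}(u,v)=0$ otherwise (the drastic product); and $T^{\mathbf{SW}}_{\lambda}(u,v)=\max\bigl(0,(1-\lambda)uv+\lambda(u+v-1)\bigr)$ for $\lambda\in\,]0,\infty[$. *)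

(* Defs.v *)
From mathcomp Require Import all_boot all_order all_algebra.
From mathcomp Require Import interval_inference.
From mathcomp Require Import classical_sets reals constructive_ereal.
From mathcomp Require Import ring lra.

Set Implicit Arguments.
Unset Strict Implicit.
Unset Printing Implicit Defensive.

Import Order.TTheory GRing.Theory Num.Theory.
Local Open Scope ring_scope.

Record tnorm (R : realType) := TNorm {
  tnorm_op :> {i01 R} -> {i01 R} -> {i01 R};
  tnormC : commutative tnorm_op;
  tnormA : associative tnorm_op;
  tnorm_le : forall x y u v : {i01 R},
    x <= u -> y <= v -> tnorm_op x y <= tnorm_op u v;
  tnorm1x : left_id 1%:i01 tnorm_op }.

Definition dominates (R : realType) (T1 T2 : tnorm R) : Prop :=
  forall x y u v : {i01 R}, T1 (T2 x y) (T2 u v) >= T2 (T1 x u) (T1 y v).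

(* The branch at -oo is junk: [sugeno_weber] takes lambda : {nonneg \bar R},
   which is [0, +oo] with +oo included. *)
Definition sw_fun (R : realType) (lambda : \bar R) (u v : R) : R :=
  match lambda with
  | +oo%E => if Num.max u v == 1 then Num.min u v else 0
  | l%:E => if l == 0 then u * v
            else Num.max 0 ((1 - l) * u * v + l * (u + v - 1))
  | -oo%E => 0
  end.

Section SugenoWeber.
Variable R : realType.
Implicit Types (l u v w : R) (x y z : {i01 R}).

Let g l u v := (1 - l) * u * v + l * (u + v - 1).

Let g_le l u v v' : 0 <= l -> 0 <= u <= 1 -> v <= v' -> g l u v <= g l u v'.
Proof.
move=> l0 /andP[u0 u1] vv'; rewrite -subr_ge0.
have -> : g l u v' - g l u v = (u + l * (1 - u)) * (v' - v) by rewrite /g; ring.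
by rewrite mulr_ge0 ?subr_ge0// addr_ge0// mulr_ge0// subr_ge0.
Qed.

Let gC l u v : g l u v = g l v u. Proof. by rewrite /g; ring. Qed.

Let g_le_min l u v : 0 <= l -> 0 <= u <= 1 -> v <= 1 -> g l u v <= u.
Proof.
move=> l0 u01 v1; have := g_le l0 u01 v1.
by have -> : g l u 1 = u by rewrite /g; ring.
Qed.

Let gmax l u v : 0 <= l -> 0 <= u <= 1 ->
  Num.max 0 (g l u (Num.max 0 v)) = Num.max 0 (g l u v).
Proof.
move=> l0 u01; case: (leP 0 v) => // v0.
have h : g l u 0 <= 0.
  case/andP: u01 => _ u1; have -> : g l u 0 = - (l * (1 - u)) by rewrite /g; ring.
  by rewrite oppr_le0 mulr_ge0// subr_ge0.
by rewrite !max_l// (le_trans _ h)// g_le// ltW.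
Qed.

Let i01P x : 0 <= x%:num <= 1.
Proof. by apply/andP; split; [exact: ge0|exact: le1]. Qed.

Variable lambda : {nonneg \bar R}.

Let lambda_ge0 : (0 <= lambda%:num)%E. Proof. exact: ge0e. Qed.

Lemma sw_ge0 x y : 0 <= sw_fun lambda%:num x%:num y%:num.
Proof.
rewrite /sw_fun; case: lambda%:num => [l| |] //.
  by case: ifP => _; rewrite ?mulr_ge0// le_max lexx.
by case: ifP => _ //; rewrite le_min !ge0.
Qed.

Lemma sw_le1 x y : sw_fun lambda%:num x%:num y%:num <= 1.
Proof.
have [[x0 x1] [y0 y1]] := (andP (i01P x), andP (i01P y)).
have := lambda_ge0; rewrite /sw_fun.
case: lambda%:num => [l| |] //; last by case: ifP => _; rewrite ?ge_min ?x1.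
rewrite lee_fin => l0; case: ifP => _; first by rewrite mulr_ile1.
by rewrite ge_max ler01/=; apply: le_trans (g_le_min l0 (i01P x) y1) x1.
Qed.

Definition sw_op x y : {i01 R} := Itv01 (sw_ge0 x y) (sw_le1 x y).

Lemma sw_opC : commutative sw_op.
Proof.
move=> x y; apply/val_inj => /=; rewrite /sw_fun; case: lambda%:num => [l| |] //.
  by rewrite [y%:num * _]mulrC -/(g l _ _) gC.
by rewrite maxC minC.
Qed.

Lemma sw_op1x : left_id 1%:i01 sw_op.
Proof.
move=> x; apply/val_inj => /=; have [x0 x1] := andP (i01P x).
have := lambda_ge0; rewrite /sw_fun; case: lambda%:num => [l| |] //.
  by move=> _; case: ifP => _; rewrite ?mul1r// max_r//; [ring|lra].
by rewrite max_l// eqxx min_r.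
Qed.

Lemma sw_op_le (x y u v : {i01 R}) : x <= u -> y <= v -> sw_op x y <= sw_op u v.
Proof.
suff ler a b c : b <= c -> sw_op a b <= sw_op a c.
  move=> xu yv; apply: le_trans (ler _ _ _ yv) _.
  by rewrite (sw_opC x) (sw_opC u) ler.
rewrite -!num_le/= => bc; have [a0 a1] := andP (i01P a).
have [[b0 b1] [c0 c1]] := (andP (i01P b), andP (i01P c)).
have := lambda_ge0; rewrite /sw_fun; case: lambda%:num => [l| |] //.
  rewrite lee_fin => l0; case: ifP => _; first by rewrite ler_wpM2l.
  rewrite ge_max le_max lexx/= le_max; apply/orP; right.
  exact: (g_le l0 (i01P a) bc).
move=> _; case: ifPn => [/eqP ab1|_]; last by case: ifP => _; rewrite ?le_min ?a0.
have -> : Num.max a%:num c%:num == 1.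
  by rewrite eq_le ge_max a1 c1/= -ab1 ge_max !le_max lexx bc orbT.
by rewrite le_min !ge_min lexx bc orbT.
Qed.

Lemma sw_opA : associative sw_op.
Proof.
move=> x y z; apply/val_inj => /=.
have [[x01 y01] z01] := (i01P x, i01P y, i01P z).
have := lambda_ge0; rewrite /sw_fun; case: lambda%:num => [l| |] //.
  rewrite lee_fin => l0; case: (l == 0); first by rewrite mulrA.
  rewrite -!/(g l _ _) gmax// [g l (Num.max _ _) _]gC gmax//; congr Num.max.
  by rewrite /g; ring.
move=> _; move: x%:num y%:num z%:num x01 y01 z01 => a b c x01 y01 z01.
have F u v : 0 <= u <= 1 -> 0 <= v <= 1 ->
    (if Num.max u v == 1 then Num.min u v else 0) =
    (if u == 1 then v else if v == 1 then u else 0).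
  move=> /andP[u0 u1] /andP[v0 v1].
  case: (eqVneq u 1) => [->|nu]; first by rewrite max_l// eqxx min_r.
  case: (eqVneq v 1) => [->|nv]; first by rewrite max_r// eqxx min_l.
  by case: leP => _; rewrite ?(negPf nu) ?(negPf nv).
have I u v : 0 <= u <= 1 -> 0 <= v <= 1 ->
    0 <= (if u == 1 then v else if v == 1 then u else 0) <= 1.
  by do 2 case: ifP => _ //; rewrite lexx ler01.
rewrite (F b c)// (F a b)// !F ?I//.
case: (eqVneq a 1) => [_|na]; first by [].
case: (eqVneq b 1) => [_|nb]; first by rewrite (negPf na).
have n01 : (0 == 1 :> R) = false by rewrite eq_sym oner_eq0.
by case: (eqVneq c 1) => [_|nc]; rewrite ?n01 ?(negPf nb)//.
Qed.

Definition sugeno_weber : tnorm R := TNorm sw_opC sw_opA sw_op_le sw_op1x.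

End SugenoWeber.

(* Main.v *)
(* In the coordinates [p = 1 - x] the operation T^SW_l is, up to truncation,
   [E_l(p, q) = p + q + (l - 1) p q], and the two sides of the dominance
   inequality for (l, m) differ by
     [(m - l) (p s + q r - (l - 1) (m - 1) p q r s)].
   Truncation makes the inequality trivial unless its smaller side is positive,
   so for [l < m] dominance means that the last factor is nonnegative wherever
   this is the case.  This always holds when [l <= 1].  When [1 < l], scaling
   (p, q, r, s) by [k] with [k^2 = (l - 1) / (l' - 1)] carries a violation for
   (l, m) to a violation for (l', m), for every [l < l' < m].  Hence T_l' >> T_m
   implies T_l >> T_m, and transitivity follows because dominance forces the
   order of the parameters. *)
Require Import Defs.
From mathcomp Require Import all_boot all_order all_algebra.
From mathcomp Require Import interval_inference.
From mathcomp Require Import classical_sets reals constructive_ereal.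
From mathcomp Require Import ring lra.

Import Order.TTheory GRing.Theory Num.Theory.
Local Open Scope classical_set_scope.
Local Open Scope ring_scope.

(** * Facts about arbitrary t-norms *)

Section TNorms.
Context {R : realType}.
Implicit Types (T : tnorm R) (x y u v : {i01 R}).

Lemma tnormx1 T x : T x 1%:i01 = x.
Proof. by rewrite tnormC tnorm1x. Qed.

(** By associativity and commutativity both sides are the same fourfold product. *)
Lemma dominates_refl T : dominates T T.
Proof.
move=> x y u v; rewrite -!tnormA (tnormA T u y v) (tnormC T u y).
by rewrite -(tnormA T y u v).
Qed.

Lemma dominates_pointwise T1 T2 x y : dominates T1 T2 -> T2 x y <= T1 x y.
Proof.
by move=> /(_ x 1%:i01 1%:i01 y); rewrite !tnormx1 !tnorm1x.
Qed.

(** Both arguments bound [T x y] from above, because 1 is at once neutral and the top element. *)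
Lemma tnorm_eq1 T x y : T x y = 1%:i01 -> x = 1%:i01 /\ y = 1%:i01.
Proof.
have le1i z : z <= 1%:i01 by rewrite -num_le/=; exact: le1.
move=> Txy; split; apply/le_anti; rewrite le1i/= -{1}Txy.
  by rewrite -{2}(tnormx1 T x) tnorm_le.
by rewrite -{2}(tnorm1x T y) tnorm_le.
Qed.

End TNorms.

(** * Dominance as a polynomial inequality in the coordinates [p = 1 - x] *)

Section Coordinates.
Context {R : realFieldType}.
Implicit Types l m p q r s x y : R.

(** The polynomial [(1 - l) x y + l (x + y - 1)] rearranged to isolate [l]. On the unit square the
    case [l = 0] needs no branch of its own. *)
Definition sw_trunc l x y := Num.max 0 (x * y - l * (1 - x) * (1 - y)).

Definition sw_conorm l p q := p + q + (l - 1) * (p * q).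

Lemma sw_truncE l p q :
  sw_trunc l (1 - p) (1 - q) = Num.max 0 (1 - sw_conorm l p q).
Proof. by rewrite /sw_trunc /sw_conorm; congr Num.max; ring. Qed.

Lemma sw_trunc_lt1 l p q : sw_conorm l p q < 1 ->
  sw_trunc l (1 - p) (1 - q) = 1 - sw_conorm l p q.
Proof. by move=> lt1; rewrite sw_truncE max_r// subr_ge0 ltW. Qed.

Lemma sw_trunc_ge1 l p q : 1 <= sw_conorm l p q ->
  sw_trunc l (1 - p) (1 - q) = 0.
Proof. by move=> ge1; rewrite sw_truncE max_l// subr_le0. Qed.

Lemma sw_truncC l x y : sw_trunc l x y = sw_trunc l y x.
Proof. by rewrite /sw_trunc; congr Num.max; ring. Qed.

Lemma sw_conormC l p q : sw_conorm l p q = sw_conorm l q p.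
Proof. by rewrite /sw_conorm; ring. Qed.

Lemma sw_trunc0 l y : 0 <= l -> y <= 1 -> sw_trunc l 0 y = 0.
Proof.
move=> l0 y1; rewrite /sw_trunc max_l//.
have : 0 <= l * (1 - y) by rewrite mulr_ge0// subr_ge0.
lra.
Qed.

Lemma sw_conorm_ler l p q q' : 0 <= l -> 0 <= p <= 1 -> q <= q' ->
  sw_conorm l p q <= sw_conorm l p q'.
Proof.
move=> l0 /andP[p0 p1] qq'; rewrite -subr_ge0.
have -> : sw_conorm l p q' - sw_conorm l p q = (1 - p + l * p) * (q' - q).
  by rewrite /sw_conorm; ring.
by rewrite mulr_ge0 ?subr_ge0// addr_ge0 ?subr_ge0// mulr_ge0.
Qed.

Lemma sw_conorm_le l p q p' q' : 0 <= l -> 0 <= p -> p <= p' <= 1 ->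
  0 <= q <= 1 -> q <= q' -> sw_conorm l p q <= sw_conorm l p' q'.
Proof.
move=> l0 p0 /andP[pp' p'1] q01 qq'.
apply: (@le_trans _ _ (sw_conorm l p' q)).
  by rewrite ![sw_conorm l _ q]sw_conormC sw_conorm_ler.
by rewrite sw_conorm_ler// p'1 (le_trans p0).
Qed.

Lemma le_sw_conorm l p q : 0 <= l -> 0 <= p <= 1 -> 0 <= q ->
  p <= sw_conorm l p q.
Proof.
move=> l0 p01 q0; apply: le_trans (sw_conorm_ler _ _ _ _ l0 p01 q0).
by rewrite /sw_conorm mulr0 mulr0 !addr0.
Qed.

Lemma sw_conorm_interchange l m p q r s :
  sw_conorm m (sw_conorm l p r) (sw_conorm l q s) -
    sw_conorm l (sw_conorm m p q) (sw_conorm m r s) =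
  (m - l) * (p * s + q * r - (l - 1) * (m - 1) * (p * q * r * s)).
Proof. by rewrite /sw_conorm; ring. Qed.

Definition trunc_dominates l m := forall x y u v,
  0 <= x <= 1 -> 0 <= y <= 1 -> 0 <= u <= 1 -> 0 <= v <= 1 ->
  sw_trunc m (sw_trunc l x u) (sw_trunc l y v) <=
  sw_trunc l (sw_trunc m x y) (sw_trunc m u v).

(** The three strict bounds say that no truncation acts on the smaller side of the dominance
    inequality. *)
Definition conorm_condition l m := forall p q r s,
  0 <= p <= 1 -> 0 <= q <= 1 -> 0 <= r <= 1 -> 0 <= s <= 1 ->
  sw_conorm l p r < 1 -> sw_conorm l q s < 1 ->
  sw_conorm m (sw_conorm l p r) (sw_conorm l q s) < 1 ->
  (l - 1) * (m - 1) * (p * q * r * s) <= p * s + q * r.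

(** Since [p] and [r] lie below [sw_conorm l p r], and [q] and [s] below [sw_conorm l q s],
    monotonicity of [sw_conorm m] passes the bound on. Hence the inner values on the larger side are
    not truncated either. *)
Lemma conorm_lt1 l m p q r s : 0 <= l -> 0 <= m ->
  0 <= p <= 1 -> 0 <= q <= 1 -> 0 <= r <= 1 -> 0 <= s <= 1 ->
  sw_conorm l p r < 1 -> sw_conorm l q s < 1 ->
  sw_conorm m (sw_conorm l p r) (sw_conorm l q s) < 1 ->
  sw_conorm m p q < 1 /\ sw_conorm m r s < 1.
Proof.
move=> l0 m0 p01 q01 r01 s01 pr1 qs1 lt1.
have [/andP[p0 _] /andP[q0 _]] := (p01, q01).
have [/andP[r0 _] /andP[s0 _]] := (r01, s01).
split; apply: le_lt_trans lt1; apply: sw_conorm_le => //.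
- by rewrite le_sw_conorm//= ltW.
- by rewrite le_sw_conorm.
- by rewrite sw_conormC le_sw_conorm//= sw_conormC ltW.
- by rewrite sw_conormC le_sw_conorm.
Qed.

Lemma trunc_dominatesP l m : 0 <= l -> l < m ->
  trunc_dominates l m <-> conorm_condition l m.
Proof.
move=> l0 lm; have m0 : 0 <= m by rewrite (le_trans l0)// ltW.
have opp01 (z : R) : 0 <= z <= 1 -> 0 <= 1 - z <= 1 by lra.
split=> [dom p q r s p01 q01 r01 s01 pr1 qs1 lt1|cond x y u v].
  have [pq1 rs1] := conorm_lt1 _ _ _ _ _ _ l0 m0 p01 q01 r01 s01 pr1 qs1 lt1.
  have := dom _ _ _ _ (opp01 _ p01) (opp01 _ q01) (opp01 _ r01) (opp01 _ s01).
  rewrite !(sw_trunc_lt1 _ _ _ pr1, sw_trunc_lt1 _ _ _ qs1).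
  rewrite !(sw_trunc_lt1 _ _ _ pq1, sw_trunc_lt1 _ _ _ rs1).
  (* The smaller side is positive, so it cannot lie below the entry 0 of the outer maximum and must
     lie below the polynomial. *)
  rewrite (sw_trunc_lt1 _ _ _ lt1) sw_truncE le_max leNgt subr_gt0 lt1/=.
  rewrite lerD2l lerN2 -subr_ge0 sw_conorm_interchange.
  by rewrite pmulr_rge0 ?subr_gt0// subr_ge0.
move=> /opp01 p01 /opp01 q01 /opp01 r01 /opp01 s01.
rewrite -(subKr 1 x) -(subKr 1 y) -(subKr 1 u) -(subKr 1 v).
move: (1 - x) (1 - y) (1 - u) (1 - v) p01 q01 r01 s01.
move=> p q r s p01 q01 r01 s01.
have trunc_ge0 (a b c : R) : 0 <= sw_trunc a b c by rewrite /sw_trunc le_max lexx.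
have trunc_le1 (a b : R) : 0 <= a <= 1 -> 0 <= b <= 1 ->
    sw_trunc l (1 - a) (1 - b) <= 1.
  move=> /[dup] a01 /andP[a0 _] /andP[b0 _].
  by rewrite sw_truncE ge_max ler01/= gerBl (le_trans a0)// le_sw_conorm.
(* Any truncation on the smaller side, inner or outer, makes that side 0; these three cases are
   removed first. *)
have [pr1|pr1] := leP 1 (sw_conorm l p r).
  by rewrite (sw_trunc_ge1 _ _ _ pr1) sw_trunc0 ?trunc_le1.
have [qs1|qs1] := leP 1 (sw_conorm l q s).
  by rewrite (sw_trunc_ge1 _ _ _ qs1) sw_truncC sw_trunc0 ?trunc_le1.
rewrite (sw_trunc_lt1 _ _ _ pr1) (sw_trunc_lt1 _ _ _ qs1).
have [ge1|lt1] := leP 1 (sw_conorm m (sw_conorm l p r) (sw_conorm l q s)).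
  by rewrite (sw_trunc_ge1 _ _ _ ge1).
have [pq1 rs1] := conorm_lt1 _ _ _ _ _ _ l0 m0 p01 q01 r01 s01 pr1 qs1 lt1.
rewrite (sw_trunc_lt1 _ _ _ lt1).
rewrite (sw_trunc_lt1 _ _ _ pq1) (sw_trunc_lt1 _ _ _ rs1) sw_truncE.
rewrite le_max; apply/orP; right.
rewrite lerD2l lerN2 -subr_ge0 sw_conorm_interchange.
by rewrite mulr_ge0 ?subr_ge0 ?cond// ltW.
Qed.

(** The coefficient is at most 1, as [1 - (l - 1) (m - 1) = l + (1 - l) m], and [p q r s <= p s] on
    the unit cube. *)
Lemma conorm_condition_le1 l m : 0 <= l <= 1 -> l <= m -> conorm_condition l m.
Proof.
move=> /andP[l0 l1] lm p q r s /andP[p0 p1] /andP[q0 q1] /andP[r0 r1] /andP[s0 s1].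
move=> _ _ _.
have c1 : (l - 1) * (m - 1) <= 1.
  have : 0 <= (1 - l) * m by rewrite mulr_ge0 ?subr_ge0// (le_trans l0).
  nra.
have pqrs0 : 0 <= p * q * r * s by rewrite !mulr_ge0.
apply: (@le_trans _ _ (p * q * r * s)); first by rewrite ler_piMl.
have -> : p * q * r * s = (q * r) * (p * s) by ring.
apply: (@le_trans _ _ (p * s)); last by rewrite lerDl mulr_ge0.
by rewrite ler_piMl ?mulr_ge0// mulr_ile1.
Qed.

End Coordinates.

(** * The scaling argument for [1 < l] *)

Lemma conorm_condition_anti (R : rcfType) (l l' m : R) :
  1 < l -> l <= l' -> l' <= m -> conorm_condition l' m -> conorm_condition l m.
Proof.
move=> l1 ll' lm cond p q r s p01 q01 r01 s01 pr1 qs1 lt1.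
have l'1 : 0 < l' - 1 by lra.
have la1 : 0 < l - 1 by lra.
have m0 : 0 <= m by lra.
set k := Num.sqrt ((l - 1) / (l' - 1)).
have k2 : k ^+ 2 * (l' - 1) = l - 1.
  by rewrite sqr_sqrtr ?divr_ge0 ?ltW// divfK// gt_eqF.
have k0 : 0 < k by rewrite sqrtr_gt0 divr_gt0.
have k1 : k <= 1.
  by rewrite -[1]sqrtr1 ler_wsqrtr// ler_pdivrMr// mul1r; lra.
have k01 (a : R) : 0 <= a <= 1 -> 0 <= k * a <= 1.
  by move=> /andP[a0 a1]; rewrite mulr_ge0 ?(ltW k0)//= mulr_ile1// ltW.
(* The choice of [k] preserves the bilinear term exactly, while [k <= 1] shrinks the linear part; so
   the scaled point still meets the strict bounds. *)
have scale (a b : R) : 0 <= a <= 1 -> 0 <= b <= 1 ->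
    sw_conorm l' (k * a) (k * b) <= sw_conorm l a b.
  move=> /andP[a0 _] /andP[b0 _]; rewrite /sw_conorm -k2.
  have -> : (l' - 1) * (k * a * (k * b)) = k ^+ 2 * (l' - 1) * (a * b) by ring.
  by rewrite lerD2r -mulrDr ler_piMl// addr_ge0.
have cn0 (a b : R) : 0 <= a <= 1 -> 0 <= b <= 1 -> 0 <= sw_conorm l' (k * a) (k * b).
  move=> /k01 /[dup] a01 /andP[a0 _] /k01 /andP[b0 _].
  by rewrite (le_trans a0)// le_sw_conorm//; lra.
have pr1' := le_lt_trans (scale _ _ p01 r01) pr1.
have qs1' := le_lt_trans (scale _ _ q01 s01) qs1.
have := cond _ _ _ _ (k01 _ p01) (k01 _ q01) (k01 _ r01) (k01 _ s01) pr1' qs1'.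
have lt1' : sw_conorm m (sw_conorm l' (k * p) (k * r))
    (sw_conorm l' (k * q) (k * s)) < 1.
  apply: le_lt_trans lt1; apply: sw_conorm_le => //.
  - exact: cn0.
  - by rewrite scale//= ltW.
  - by rewrite cn0//= ltW.
  - exact: scale.
move=> /(_ lt1'); rewrite -k2.
(* The quartic side gains [k ^+ 4], of which [k ^+ 2] turns [l' - 1] into [l - 1]; the remaining
   [k ^+ 2] cancels against the quadratic side. *)
have -> : (l' - 1) * (m - 1) * (k * p * (k * q) * (k * r) * (k * s)) =
  k ^+ 2 * (k ^+ 2 * (l' - 1) * (m - 1) * (p * q * r * s)) by ring.
have -> : k * p * (k * s) + k * q * (k * r) = k ^+ 2 * (p * s + q * r) by ring.
by rewrite ler_pM2l// exprn_gt0.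
Qed.

(** * Back to the t-norms, with the infinite parameter included *)

Section SugenoWeberDominance.
Context {R : realType}.
Implicit Types (a b c : {nonneg \bar R}) (l m : R) (x y : {i01 R}).

Lemma sw_fun_fin l (u v : R) : 0 <= u -> 0 <= v ->
  sw_fun l%:E u v = sw_trunc l u v.
Proof.
move=> u0 v0; rewrite /sw_fun /sw_trunc; case: eqP => [->|_].
  by rewrite max_r !mul0r subr0// mulr_ge0.
by congr Num.max; ring.
Qed.

Lemma sugeno_weber_fin a l x y : a%:num = l%:E ->
  (sugeno_weber a x y)%:num = sw_trunc l x%:num y%:num.
Proof. by move=> al; rewrite /= al sw_fun_fin// ge0. Qed.

Lemma dominates_trunc a b l m : a%:num = l%:E -> b%:num = m%:E ->
  dominates (sugeno_weber a) (sugeno_weber b) <-> trunc_dominates l m.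
Proof.
move=> al bm; split=> dom.
  move=> x y u v /andP[x0 x1] /andP[y0 y1] /andP[u0 u1] /andP[v0 v1].
  have := dom (Itv01 x0 x1) (Itv01 y0 y1) (Itv01 u0 u1) (Itv01 v0 v1).
  rewrite -num_le (sugeno_weber_fin _ _ _ _ al) (sugeno_weber_fin _ _ _ _ bm).
  by rewrite !(sugeno_weber_fin _ _ _ _ al) !(sugeno_weber_fin _ _ _ _ bm).
move=> x y u v.
rewrite -num_le (sugeno_weber_fin _ _ _ _ al) (sugeno_weber_fin _ _ _ _ bm).
rewrite !(sugeno_weber_fin _ _ _ _ al) !(sugeno_weber_fin _ _ _ _ bm).
by apply: dom; rewrite ge0 le1.
Qed.

Lemma nonneg_ereal_num a : (exists2 l, a%:num = l%:E & 0 <= l) \/ a%:num = +oo%E.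
Proof.
have : (0 <= a%:num)%E by exact: ge0e.
by case: a%:num => [l l0| |]//; [left; exists l|right].
Qed.

(** The drastic product vanishes unless an argument is 1. If [T x u] is 1, then [x = u = 1] and both
    sides equal [T y v]; the other case is symmetric. *)
Lemma dominates_pinfty (T : tnorm R) c : c%:num = +oo%E ->
  dominates T (sugeno_weber c).
Proof.
move=> coo x y u v; set S := sugeno_weber c.
have [xu1|nxu] := eqVneq (T x u) 1%:i01.
  by have [-> ->] := tnorm_eq1 _ _ _ xu1; rewrite !tnorm1x.
have [yv1|nyv] := eqVneq (T y v) 1%:i01.
  by have [-> ->] := tnorm_eq1 _ _ _ yv1; rewrite !tnormx1.
suff S0 : (S (T x u) (T y v))%:num = 0 by rewrite -num_le S0 ge0.
rewrite /= coo /=; case: ifPn => // /eqP.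
have neq1 (z : {i01 R}) : z != 1%:i01 -> z%:num != 1.
  by apply: contra => /eqP z1; apply/eqP/val_inj.
by case: leP => _ /eqP; rewrite (negPf (neq1 _ nxu), negPf (neq1 _ nyv)).
Qed.

Lemma dominates_param_le a b :
  dominates (sugeno_weber a) (sugeno_weber b) -> (a%:num <= b%:num)%E.
Proof.
move=> dom; have [[m bm m0]|->] := nonneg_ereal_num b; last exact: leey.
(* Dominance implies the pointwise order, tested at the diagonal point [1 - p]. This [p] is small
   enough for the value with parameter [m] to be positive, so the parameters can be read off; the
   drastic product is 0 there. *)
rewrite bm; have p0 : 0 < (m + 3)^-1 by rewrite invr_gt0; lra.
have p1 : (m + 3)^-1 < 1 by rewrite invf_lt1; lra.
set p := (m + 3)^-1 in p0 p1.
have x0 : 0 <= 1 - p by lra.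
have x1 : 1 - p <= 1 by lra.
have := dominates_pointwise _ _ (Itv01 x0 x1) (Itv01 x0 x1) dom.
rewrite -num_le (sugeno_weber_fin _ _ _ _ bm).
have pos : 0 < (1 - p) * (1 - p) - m * (1 - (1 - p)) * (1 - (1 - p)).
  have -> : (1 - p) * (1 - p) - m * (1 - (1 - p)) * (1 - (1 - p)) =
    p ^+ 2 * ((m + 2) ^+ 2 - m) by rewrite /p; field; apply: lt0r_neq0; lra.
  by rewrite mulr_gt0 ?exprn_gt0//; nra.
have [[l al l0]|aoo] := nonneg_ereal_num a.
  rewrite (sugeno_weber_fin _ _ _ _ al) al lee_fin /sw_trunc.
  rewrite [X in X <= _](max_r (ltW pos)) le_max leNgt pos/= lerD2l lerN2.
  by rewrite subKr !ler_pM2r.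
rewrite /= aoo /= maxxx lt_eqF; last by lra.
by rewrite /sw_trunc ge_max lexx/= leNgt pos.
Qed.

Lemma dominates_sw_anti a b :
  dominates (sugeno_weber a) (sugeno_weber b) ->
  dominates (sugeno_weber b) (sugeno_weber a) -> a = b.
Proof.
by move=> /dominates_param_le ab /dominates_param_le ba; apply/val_inj/le_anti/andP.
Qed.

Lemma dominates_sw_trans a b c :
  dominates (sugeno_weber a) (sugeno_weber b) ->
  dominates (sugeno_weber b) (sugeno_weber c) ->
  dominates (sugeno_weber a) (sugeno_weber c).
Proof.
move=> domab dombc.
have := dominates_param_le _ _ domab; have := dominates_param_le _ _ dombc.
have [[n cn n0]|/dominates_pinfty//] := nonneg_ereal_num c.
have [[m bm m0]|->] := nonneg_ereal_num b; last by rewrite cn.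
have [[l al l0]|->] := nonneg_ereal_num a; last by rewrite bm.
(* The case [m = n] is split off because [trunc_dominatesP] requires strictly ordered parameters. *)
rewrite al bm cn !lee_fin le_eqVlt => /predU1P[mn _|mn lm].
  suff <- : b = c by [].
  by apply/val_inj; rewrite /= bm cn mn.
apply/(dominates_trunc _ _ _ _ al cn)/trunc_dominatesP => //.
  exact: le_lt_trans mn.
have [l1|l1] := leP l 1.
  by apply: conorm_condition_le1; [rewrite l0|rewrite (le_trans lm)// ltW].
apply: (conorm_condition_anti _ _ _ _ l1 lm (ltW mn)).
exact/trunc_dominatesP/(dominates_trunc _ _ _ _ bm cn).
Qed.

End SugenoWeberDominance.

Theorem proposition3 (R : realType) :
  let SW : set (tnorm R) := range (@sugeno_weber R) in
  [/\ (forall T : tnorm R, SW T -> dominates T T),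
      (forall T1 T2 : tnorm R, SW T1 -> SW T2 ->
         dominates T1 T2 -> dominates T2 T1 -> T1 = T2),
      (forall T1 T2 T3 : tnorm R, SW T1 -> SW T2 -> SW T3 ->
         dominates T1 T2 -> dominates T2 T3 -> dominates T1 T3)
    & (forall a b c : {nonneg \bar R},
         dominates (sugeno_weber a) (sugeno_weber b) ->
         dominates (sugeno_weber b) (sugeno_weber c) ->
         dominates (sugeno_weber a) (sugeno_weber c))].
Proof.
split.
- by move=> T _; exact: dominates_refl.
- by move=> _ _ [a _ <-] [b _ <-] ab ba; rewrite (dominates_sw_anti _ _ ab ba).
- by move=> _ _ _ [a _ <-] [b _ <-] [c _ <-]; exact: dominates_sw_trans.
- exact: dominates_sw_trans.
Qed.
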